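(* Let $m,n$ be positive integers and let $K_{m\times n}$ be the $m\times n$ king graph. Let $P_{m\times n}(z)$ be the domination polynomial of $K_{m\times n}$. Then \[ P_{m\times n}(-1) = (-1)^{\lceil m/2\rceil \lceil n/2\rceil}. \]
   Context: The $m\times n$ king graph $K_{m\times n}=(V,E)$ has vertex set $V=[m]\times[n]$, where $[k]=\{1,\dots,k\}$, and $((x,y),(x',y'))\in E$ if and only if $\max(|x-x'|,|y-y'|)=1$. A dominating set of a graph $G=(V,E)$ is a subset $S\subseteq V$ such that every vertex of $V$ is in $S$ or has a neighbor in $S$. The domination polynomial of $G$ is $P_G(z)=\sum_{S\subseteq V,\ S \text{ dominating}} z^{|S|}=\sum_{k=0}^{|V|} N_k z^k$, where $N_k$ is the number of dominating sets of size $k$. *)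

(* Defs.v *)
From mathcomp Require Import all_boot all_order all_algebra.
Set Implicit Arguments.
Unset Strict Implicit.
Unset Printing Implicit Defensive.
Import GRing.Theory.
Local Open Scope ring_scope.

(* A finite simple graph is given by its adjacency relation on a finType. *)

Definition dominating (T : finType) (e : rel T) (S : {set T}) : bool :=
  [forall v, (v \in S) || [exists u in S, e v u]].

Definition domination_poly (T : finType) (e : rel T) : {poly int} :=
  \sum_(S : {set T} | dominating e S) 'X^#|S|.

(* Coordinates run over {0, ..., m-1} x {0, ..., n-1} rather than
   {1, ..., m} x {1, ..., n}; adjacency only involves coordinate differences.
   The differences below are taken in int, so they are not truncated. *)
Definition king_graph (m n : nat) : rel ('I_m * 'I_n) :=
  fun u v => maxn `|u.1 - v.1|%N `|u.2 - v.2|%N == 1%N.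

Lemma king_graph_sym (m n : nat) : symmetric (@king_graph m n).
Proof. by move=> u v; rewrite /king_graph distnC (distnC u.2). Qed.

Lemma king_graph_irr (m n : nat) : irreflexive (@king_graph m n).
Proof. by move=> u; rewrite /king_graph !distnn. Qed.

Lemma coef_domination_poly (T : finType) (e : rel T) (k : nat) :
  (domination_poly e)`_k =
    #|[set S : {set T} | dominating e S & #|S| == k]|%:Z.
Proof.
rewrite /domination_poly coef_sum -sum1dep_card -natz natr_sum.
rewrite [LHS](bigID (fun S : {set T} => #|S| == k)) /= [X in _ + X]big1.
  by rewrite addr0; apply: eq_bigr => S /andP[_ /eqP <-]; rewrite coefXn eqxx.
by move=> S /andP[_ /negPf nk]; rewrite coefXn eq_sym nk.
Qed.

(* Main.v *)
Require Import Defs.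
From mathcomp Require Import all_boot all_order all_algebra.
From mathcomp Require Import zify.
Set Implicit Arguments.
Unset Strict Implicit.
Unset Printing Implicit Defensive.
Import GRing.Theory.
Local Open Scope ring_scope.

(** If the closed neighbourhood of a vertex p is contained in that of another
    vertex q, then deleting q does not change the domination polynomial at -1:
    the dominating sets containing q cancel in pairs under toggling p, and a
    set avoiding q that dominates p also dominates q.  In the king graph (with
    coordinates starting at 0) one can delete in this way the rows 1, 3, 5, ...
    in increasing order, each vertex being compared with its neighbour in the
    preceding row, and then likewise the columns 1, 3, 5, ...  What remains is
    an independent set with ceil(m/2) * ceil(n/2) vertices, whose only
    dominating set is itself. *)

(* Here [r] plays the role of the closed adjacency relation. *)
Definition covers (T : finType) (r : rel T) (V S : {set T}) : bool :=
  [forall v in V, exists u in S, r v u].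

(** For a closed adjacency relation this is the domination polynomial at -1 of the subgraph induced
    on [V]; keeping [T] fixed lets vertices be deleted without a change of type. *)
Definition signed_covers (T : finType) (r : rel T) (V : {set T}) : int :=
  \sum_(S : {set T} | (S \subset V) && covers r V S) (-1) ^+ #|S|.

Definition toggle (T : finType) (p : T) (S : {set T}) : {set T} :=
  if p \in S then S :\ p else p |: S.

Section Covers.
Variables (T : finType) (r : rel T).
Implicit Types (p q u v : T) (S V B : {set T}).

Lemma coversP V S :
  reflect (forall v, v \in V -> exists2 u, u \in S & r v u) (covers r V S).
Proof.
apply: (iffP forall_inP) => h v vV; first by case/exists_inP: (h v vV) => u; exists u.
by case: (h v vV) => u uS ru; apply/exists_inP; exists u.
Qed.

Lemma toggleK p : involutive (@toggle T p).
Proof.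
move=> S; rewrite /toggle; case pS: (p \in S); first by rewrite setD11 setD1K.
by rewrite setU11 setU1K ?pS.
Qed.

Lemma in_toggle p S u : u != p -> (u \in toggle p S) = (u \in S).
Proof. by rewrite /toggle => /negPf up; case: ifP => _; rewrite !inE up. Qed.

Lemma toggle_sub p S V : p \in V -> (toggle p S \subset V) = (S \subset V).
Proof.
move=> pV; rewrite /toggle; case: ifP => pS; last by rewrite subUset sub1set pV.
by rewrite -{2}(setD1K pS) subUset sub1set pV.
Qed.

Lemma sign_toggle p S : (-1) ^+ #|toggle p S| = - (-1) ^+ #|S| :> int.
Proof.
rewrite /toggle; case: ifP => pS.
  by rewrite (cardsD1 p S) pS exprS mulN1r opprK.
by rewrite cardsU1 pS exprS mulN1r.
Qed.

(** If the toggle removes [p], whatever [p] dominated is still dominated by [q], which stays in the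
    set. *)
Lemma covers_toggle p q V S : p != q -> q \in S ->
    (forall v, v \in V -> r v p -> r v q) ->
  covers r V S -> covers r V (toggle p S).
Proof.
move=> pq qS sub /coversP h; apply/coversP => v vV; case: (h v vV) => u uS ru.
have [up|up] := eqVneq u p; last by exists u; rewrite ?in_toggle.
exists q; first by rewrite in_toggle // eq_sym.
by apply: sub => //; rewrite -up.
Qed.

Hypothesis r_sym : symmetric r.

Lemma signed_covers_delete p q V : p \in V -> q \in V -> p != q ->
    (forall v, v \in V -> r p v -> r q v) ->
  signed_covers r V = signed_covers r (V :\ q).
Proof.
move=> pV qV pq sub.
have sub' v : v \in V -> r v p -> r v q by rewrite ![r v _]r_sym; apply: sub.
rewrite [LHS](bigID (fun S : {set T} => q \in S)) /= [X in X + _](_ : _ = 0).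
  rewrite add0r; apply: eq_bigl => S; rewrite subsetD1.
  rewrite -!andbA; apply: andb_id2l => SV; rewrite andbC; apply: andb_id2l => _.
  apply/coversP/coversP => h v; first by case/setD1P => _; apply: h.
  have [-> _|vq vV] := eqVneq v q; last by apply: h; rewrite !inE vq.
  have [|u uS ru] := h p; first by rewrite !inE pq.
  by exists u => //; apply: sub => //; apply: (subsetP SV).
(* Toggling [p] permutes the sets containing [q] that are summed here and flips each sign, so the
   sum equals its own opposite. *)
set X := (LHS); suff: - X == X by rewrite Num.Theory.eqNr => /eqP.
rewrite {2}/X (reindex_inj (inv_inj (@toggleK p))) /= -sumrN.
apply/eqP; apply: eq_big => [S|S _]; last by rewrite sign_toggle.
rewrite toggle_sub // in_toggle 1?eq_sym //.
rewrite -!andbA; apply: andb_id2l => _; apply: andb_id2r => qS.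
apply/idP/idP; first exact: covers_toggle sub'.
(* The converse is the same implication applied to [toggle p S], since toggling twice restores
   [S]. *)
move/(@covers_toggle p q V _ pq); rewrite toggleK; apply=> //.
by rewrite in_toggle // eq_sym.
Qed.

(* The vertices outside [B] are deleted in increasing order of [f]. *)
Lemma signed_covers_restrict (f : T -> nat) B V : B \subset V ->
    (forall q, q \in V -> q \notin B -> exists2 p, p \in B &
      forall v, v \in V -> (v \in B) || (f q <= f v)%N -> r p v -> r q v) ->
  signed_covers r V = signed_covers r B.
Proof.
have [k] := ubnP #|V :\: B|; elim: k V => // k IH V leVk BV h.
have [/eqP|[q0 q0VB]] := set_0Vmem (V :\: B).
  by rewrite setD_eq0 => VB; congr signed_covers; apply/eqP; rewrite eqEsubset VB.
case: (arg_minnP f q0VB) => q qVB qmin.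
have /setDP[qV qB] := qVB; have [p pB sub] := h q qV qB.
rewrite (@signed_covers_delete p q) // ?(subsetP BV) //.
- apply: IH.
  + rewrite -ltnS; apply: leq_trans leVk; rewrite ltnS; apply: proper_card.
    rewrite properE setSD ?subsetDl //=; apply/subsetPn; exists q => //.
    by rewrite !inE eqxx andbF.
  + by rewrite subsetD1 BV.
  (* The witness [p'] lies in [B], so it is never deleted and the hypothesis survives in
     [V :\ q]. *)
  + move=> q' /setD1P[_ q'V] q'B; have [p' p'B sub'] := h q' q'V q'B.
    by exists p' => // v /setD1P[_ vV]; apply: sub'.
- by apply: contraNneq qB => <-.
- move=> v vV; apply: sub => //; case: (boolP (v \in B)) => //= vB.
  by apply: qmin; apply/setDP.
Qed.

Lemma signed_covers_indep B :
  {in B &, forall u v, r u v = (u == v)} -> signed_covers r B = (-1) ^+ #|B|.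
Proof.
move=> ind; rewrite /signed_covers (big_pred1 B) // => S /=.
rewrite eqEsubset; apply: andb_id2l => SB; apply/coversP/subsetP => h v vB.
  by case: (h v vB) => u uS; rewrite ind ?(subsetP SB u) // => /eqP ->.
by exists v; rewrite ?ind ?h.
Qed.

End Covers.

Lemma domination_poly_at_m1 (T : finType) (e : rel T) :
  (domination_poly e).[-1] = signed_covers (fun v u => (v == u) || e v u) setT.
Proof.
rewrite /domination_poly horner_sum; apply: eq_big => [S|S _]; last first.
  by rewrite hornerXn.
rewrite subsetT; apply/forallP/coversP => [h v _|h v].
  have /orP[vS|/exists_inP[u uS euv]] := h v; first by exists v; rewrite ?eqxx.
  by exists u; rewrite ?euv ?orbT.
have [//|u uS /orP[/eqP->|euv]] := h v; first by rewrite uS.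
by apply/orP; right; apply/exists_inP; exists u.
Qed.

Lemma card_even_ord n : #|[set i : 'I_n | ~~ odd i]| = uphalf n.
Proof.
rewrite -sum1dep_card -(big_mkord (fun i => ~~ odd i) (fun=> 1%N)).
elim: n => [|n IH]; first by rewrite big_geq.
by rewrite big_mkcond big_nat_recr //= -big_mkcond IH /=; case: ifP; lia.
Qed.

Definition king_closed (m n : nat) : rel ('I_m * 'I_n) :=
  fun u v => (`|u.1 - v.1| <= 1)%N && (`|u.2 - v.2| <= 1)%N.

Lemma king_closedE m n u v :
  (u == v) || @king_graph m n u v = king_closed u v.
Proof.
case: u v => [x y] [x' y']; rewrite /king_graph /king_closed xpair_eqE -!val_eqE /=.
lia.
Qed.

(* [uphalf k] is the ceiling of k / 2. *)
Theorem theorem1 (m n : nat) (hm : (0 < m)%N) (hn : (0 < n)%N) :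
  (domination_poly (@king_graph m n)).[-1]
    = (-1) ^+ (uphalf m * uphalf n)%N.
Proof.
have r_sym : symmetric (@king_closed m n).
  by move=> u v; rewrite /king_closed distnC (distnC u.2).
have -> : (domination_poly (@king_graph m n)).[-1]
          = signed_covers (@king_closed m n) setT.
  rewrite domination_poly_at_m1; apply: eq_bigl => S; congr (_ && _).
  by apply/coversP/coversP => h v /h[u uS rvu]; exists u;
    rewrite // ?king_closedE // -king_closedE.
pose B1 := [set v : 'I_m * 'I_n | ~~ odd v.2].
pose B := setX [set i : 'I_m | ~~ odd i] [set j : 'I_n | ~~ odd j].
rewrite (signed_covers_restrict r_sym
  (f := fun v : 'I_m * 'I_n => v.2) (subsetT B1)); last first.
  move=> [x y] _; rewrite inE /= => oy.
  have ly : (y.-1 < n)%N by have := ltn_ord y; lia.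
  (* As [y] is odd, [y.-1] is even and a true predecessor. Its neighbours with second coordinate
     [y - 2] are already deleted; the remaining ones have [y - 1] or [y], within distance 1 of
     [y]. *)
  exists (x, Ordinal ly); first by rewrite inE /=; lia.
  by move=> [x' y'] _; rewrite inE /king_closed /=; lia.
rewrite (signed_covers_restrict r_sym
  (f := fun v : 'I_m * 'I_n => v.1) (B := B)); first last.
- move=> [x y]; rewrite !inE /= => ey; rewrite ey andbT => ox.
  have lx : (x.-1 < m)%N by have := ltn_ord x; lia.
  exists (Ordinal lx, y); first by rewrite !inE /=; lia.
  by move=> [x' y']; rewrite !inE /king_closed /=; lia.
- by apply/subsetP => -[x y]; rewrite !inE => /andP[].
rewrite signed_covers_indep ?cardsX ?card_even_ord //.
(* Even numbers at distance at most 1 are equal. *)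
move=> [x y] [x' y']; rewrite !inE /king_closed xpair_eqE -!val_eqE /=.
lia.
Qed.
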